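(* Let $(S_n)_{n\ge1}$ be a demimartingale or a demisubmartingale, and let $\tau$ be a bounded stopping time such that $\tau\le M$ a.s. for some $M\in\mathbb{N}$. Assume that, for every $i=2,\ldots,M$, the indicator $I\{\tau<i\}$ is a componentwise nondecreasing function of $S_1,\ldots,S_{i-1}$. Then $$E(S_\tau)\le E(S_M).$$
   Context: All random variables live on one probability space, and functions are understood to be Borel measurable. $I\{A\}$ denotes the indicator of the event $A$. A sequence of $L^1$ random variables $(S_n)_{n\ge1}$ is a demimartingale if for all $j\ge1$, $E[(S_{j+1}-S_j)f(S_1,\ldots,S_j)]\ge 0$ for all componentwise nondecreasing functions $f:\mathbb{R}^j\to\mathbb{R}$ for which the expectation is defined; it is a demisubmartingale if this is required only for nonnegative componentwise nondecreasing $f$. A stopping time is a random variable $\tau$ with values in $\{1,2,\ldots\}\cup\{\infty\}$ with $\{\tau\le j\}\in\sigma(S_1,\ldots,S_j)$ for every $j\ge1$. ''$I\{A\}$ is a componentwise nondecreasing function of $S_1,\ldots,S_k$'' means $I\{A\}=h(S_1,\ldots,S_k)$ for some componentwise nondecreasing function $h$ on $\mathbb{R}^k$. *)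

(* Defs.v *)
From HB Require Import structures.
From mathcomp Require Import all_boot all_order all_algebra.
From mathcomp Require Import all_classical all_reals all_analysis.

Set Implicit Arguments.
Unset Strict Implicit.
Unset Printing Implicit Defensive.

Import Order.TTheory GRing.Theory Num.Theory.
Import numFieldNormedType.Exports.

Local Open Scope classical_set_scope.
Local Open Scope ring_scope.

(* Processes are indexed from 1: in [S : nat -> {RV P >-> R}] the variable
   [S 0] is never used. *)

Definition first_terms (T : Type) (R : Type) (S : nat -> T -> R) (j : nat)
    (w : T) : j.-tuple R :=
  [tuple S i.+1 w | i < j].

Definition componentwise_nondecreasing (R : realType) (j : nat)
    (f : j.-tuple R -> R) : Prop :=
  forall x y : j.-tuple R, (forall i : 'I_j, tnth x i <= tnth y i) -> f x <= f y.

(* The expectation exists as an element of [-oo, +oo]: it is not of the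
   form oo - oo (to which the library's integral still gives a value). *)
Definition expectation_defined (d : measure_display) (T : measurableType d)
    (R : realType) (P : probability T R) (X : T -> R) : Prop :=
  ((\int[P]_w ((EFin \o X)^\+ w)) +? (- \int[P]_w ((EFin \o X)^\- w)))%E.

Definition demimartingale (d : measure_display) (T : measurableType d)
    (R : realType) (P : probability T R) (S : nat -> {RV P >-> R}) : Prop :=
  (forall n : nat, (1 <= n)%N -> P.-integrable setT (EFin \o S n)) /\
  (forall (j : nat) (f : j.-tuple R -> R), (1 <= j)%N ->
    measurable_fun setT f -> componentwise_nondecreasing f ->
    let X := fun w => (S j.+1 w - S j w) * f (first_terms S j w) in
    expectation_defined P X -> (0 <= 'E_P[X])%E).

Definition demisubmartingale (d : measure_display) (T : measurableType d)
    (R : realType) (P : probability T R) (S : nat -> {RV P >-> R}) : Prop :=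
  (forall n : nat, (1 <= n)%N -> P.-integrable setT (EFin \o S n)) /\
  (forall (j : nat) (f : j.-tuple R -> R), (1 <= j)%N ->
    measurable_fun setT f -> componentwise_nondecreasing f ->
    (forall x, 0 <= f x) ->
    let X := fun w => (S j.+1 w - S j w) * f (first_terms S j w) in
    expectation_defined P X -> (0 <= 'E_P[X])%E).

(* A time is a map to [option nat], where [None] stands for infinity. *)
Definition time_le (t : option nat) (j : nat) : bool :=
  if t is Some n then (n <= j)%N else false.

Definition time_lt (t : option nat) (j : nat) : bool :=
  if t is Some n then (n < j)%N else false.

(* [g_sigma_preimage] of the j functions S_1, ..., S_j is
   sigma(S_1, ..., S_j).  Measurability of [tau] itself follows. *)
Definition stopping_time (d : measure_display) (T : measurableType d)
    (R : realType) (P : probability T R) (S : nat -> {RV P >-> R})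
    (tau : T -> option nat) : Prop :=
  (forall w n, tau w = Some n -> (1 <= n)%N) /\
  (forall j : nat, (1 <= j)%N ->
    g_sigma_preimage (fun i : 'I_j => S i.+1 : T -> R)
      [set w | time_le (tau w) j]).

(* The value 0 where [tau] is infinite is a convention; it is only used for
   almost surely finite [tau]. *)
Definition stopped (T : Type) (R : realType) (S : nat -> T -> R)
    (tau : T -> option nat) (w : T) : R :=
  if tau w is Some n then S n w else 0.

Definition is_nondecreasing_function_of (T : Type) (R : realType)
    (S : nat -> T -> R) (k : nat) (X : T -> R) : Prop :=
  exists h : k.-tuple R -> R,
    [/\ measurable_fun setT h, componentwise_nondecreasing h &
        forall w, X w = h (first_terms S k w)].

(* Main.v *)
Require Import Defs.
From HB Require Import structures.
From mathcomp Require Import all_boot all_order all_algebra.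
From mathcomp Require Import all_classical all_reals all_analysis.
From mathcomp Require Import measurable_realfun.
Import Order.TTheory GRing.Theory Num.Theory.
Import numFieldNormedType.Exports.
Local Open Scope classical_set_scope.
Local Open Scope ring_scope.

(** Write $A_j = \{\tau \le j\} = \{\tau < j+1\}$.  On the almost sure event
    $1 \le \tau \le M$ the difference $S_M - S_\tau$ telescopes into
    $\sum_{1 \le j < M} (S_{j+1} - S_j) 1_{A_j}$ ([stopped_telescope]).  By
    hypothesis $1_{A_j} = h(S_1, \ldots, S_j)$ with $h$ componentwise
    nondecreasing.  Off the range of $(S_1, \ldots, S_j)$ the function $h$ may be
    negative, but $\max(h, 0)$ is nonnegative, still nondecreasing, and
    represents the same indicator; so the demisubmartingale inequality makes
    each term of the sum have nonnegative expectation
    ([expectation_increment_ge0]).  A demimartingale is a demisubmartingale, so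
    this covers both cases.  All the terms are integrable, being integrable
    increments times indicators, and summing their expectations gives
    $E(S_M) - E(S_\tau) \ge 0$. *)

Lemma demimartingale_demisubmartingale (d : measure_display)
    (T : measurableType d) (R : realType) (P : probability T R)
    (S : nat -> {RV P >-> R}) :
  demimartingale S -> demisubmartingale S.
Proof. by move=> [iS HS]; split=> // j f j1 mf ndf _; exact: HS. Qed.

Lemma g_sigma_preimage_measurable (d d' : measure_display)
    (T : measurableType d) (U : measurableType d') (n : nat)
    (f : 'I_n -> T -> U) :
  (forall i, measurable_fun setT (f i)) -> g_sigma_preimage f `<=` measurable.
Proof.
move=> mf; apply: smallest_sub; first exact: sigma_algebra_measurable.
apply: (big_ind (fun C : set (set T) => C `<=` measurable)).
- exact: sub0set.
- by move=> C D hC hD A [/hC|/hD].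
- by move=> i _ _ [B mB <-]; exact: mf.
Qed.

Section stopping_time.
Context (d : measure_display) (T : measurableType d) (R : realType).
Context (P : probability T R) (S : nat -> {RV P >-> R}).
Context (tau : T -> option nat).
Context (tauS : stopping_time S tau).

Lemma measurable_time_le (j : nat) : measurable [set w | time_le (tau w) j].
Proof.
case: tauS => tau1 mtau; case: j => [|j]; last first.
  apply: (@g_sigma_preimage_measurable _ _ _ _ j.+1
    (fun i => S i.+1 : T -> R)) => //; exact: mtau.
(* A stopping time is at least 1. *)
rewrite (_ : [set _ | _] = set0)//; apply/seteqP; split=> // w /=.
by case E : (tau w) => [n|]//=; move: (tau1 _ _ E); case: n {E}.
Qed.

Lemma measurable_time_eq (n : nat) : measurable [set w | tau w = Some n].
Proof.
case: n => [|n].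
  rewrite (_ : [set _ | _] = [set w | time_le (tau w) 0]).
    exact: measurable_time_le.
  apply/seteqP; split=> w /= => [->//|].
  by case: (tau w) => [m|]//=; rewrite leqn0 => /eqP ->.
rewrite (_ : [set _ | _] = [set w | time_le (tau w) n.+1] `\`
    [set w | time_le (tau w) n]).
  by apply: measurableD; exact: measurable_time_le.
apply/seteqP; split=> w /=.
  by move=> ->/=; split=> //; rewrite ltnn.
case: (tau w) => [m|] /= [] // mn /negP nm.
by congr Some; apply/eqP; rewrite eqn_leq mn ltnNge.
Qed.

(** The telescoped form of $S_\tau$ agrees with it only almost surely;
    measurability of $S_\tau$ is what allows exchanging the two under the
    expectation. *)
Lemma measurable_stopped : measurable_fun setT (stopped S tau).
Proof.
move=> _ B mB; rewrite setTI.
(* The second part is where tau is infinite and the stopped value is 0. *)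
rewrite (_ : _ @^-1` _ =
  (\bigcup_n ([set w | tau w = Some n] `&` S n @^-1` B)) `|`
  (~` (\bigcup_n [set w | tau w = Some n]) `&` [set _ | B 0])).
  apply: measurableU.
    apply: bigcupT_measurable => n; apply: measurableI.
      exact: measurable_time_eq.
    by rewrite -[_ @^-1` _]setTI; exact: measurable_funPT.
  apply: measurableI; last first.
    rewrite -[X in measurable X]setTI.
    exact: (measurable_cst (0 : R) measurableT).
  apply: measurableC; apply: bigcupT_measurable => n.
  exact: measurable_time_eq.
apply/seteqP; split=> w; rewrite /stopped /=.
  case E : (tau w) => [n|] Bw; [left; by exists n|right; split=> //].
  by case=> n _ /=; rewrite E.
case=> [[n _ [/= -> //]]|[nw B0]].
by case E : (tau w) => [n|]//; case: nw; exists n.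
Qed.

Lemma stopped_telescope (M : nat) (w : T) : time_le (tau w) M ->
  stopped S tau w = S M w - \sum_(1 <= j < M)
    (S j.+1 w - S j w) * \1_[set w | time_le (tau w) j] w.
Proof.
case: tauS => tau1 _; rewrite /stopped.
case E : (tau w) => [n|]//= nM; have n1 := tau1 _ _ E.
(* The indicators vanish for j < n and equal 1 for n <= j. *)
rewrite (big_cat_nat n1 nM)/= big_nat big1 ?add0r; last first.
  move=> j /andP[_ jn]; rewrite indicE memNset ?mulr0//= E/=.
  by apply/negP; rewrite -ltnNge.
rewrite big_nat (eq_bigr (fun j => S j.+1 w - S j w)); last first.
  by move=> j /andP[nj _]; rewrite indicE mem_set ?mulr1//= E.
by rewrite -big_nat telescope_sumr// subKr.
Qed.

Lemma integrable_increment (j : nat) :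
  P.-integrable setT (EFin \o S j) -> P.-integrable setT (EFin \o S j.+1) ->
  P.-integrable setT (EFin \o
    (fun w => (S j.+1 w - S j w) * \1_[set w | time_le (tau w) j] w)).
Proof.
move=> iS iS1.
have mA := measurable_time_le j.
have := @integrableMl _ _ _ P setT measurableT
  (EFin \o (S j.+1 \- S j))
  (\1_[set w | time_le (tau w) j]).
apply.
- rewrite (_ : _ \o _ = (EFin \o S j.+1) \- (EFin \o S j))%E; last first.
    by apply/funext.
  exact: integrableB.
- exact: measurable_indic.
- exists 1; split=> // x x1 w _ /=.
  by rewrite (le_trans _ (ltW x1))// indicE; case: (_ \in _); rewrite ?normr1 ?normr0.
Qed.

Lemma expectation_increment_ge0 (j : nat) : (1 <= j)%N ->
  demisubmartingale S ->
  is_nondecreasing_function_of S j \1_[set w | time_lt (tau w) j.+1] ->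
  (0 <= 'E_P[fun w =>
    ((S j.+1 w - S j w) * \1_[set w | time_le (tau w) j] w)%R])%E.
Proof.
move=> j1 [iS HS] [h [mh ndh hE]].
have XE : (fun w => (S j.+1 w - S j w) * \1_[set w | time_le (tau w) j] w) =
    (fun w => (S j.+1 w - S j w) * Num.max (h (first_terms S j w)) 0).
  by apply/funext => w; congr (_ * _); rewrite -hE; apply/esym/max_idPl.
rewrite XE; apply: (HS j (fun x => Num.max (h x) 0) j1).
- exact: measurable_maxr.
- by move=> x y xy; rewrite ge_max !le_max ndh//= lexx orbT.
- by move=> x; rewrite le_max lexx orbT.
- rewrite -XE; apply: integrable_add_def => //.
  by apply: integrable_increment; exact: iS.
Qed.

End stopping_time.

Theorem theorem2p3 (d : measure_display) (T : measurableType d)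
    (R : realType) (P : probability T R) (S : nat -> {RV P >-> R})
    (tau : T -> option nat) (M : nat) :
  demimartingale S \/ demisubmartingale S ->
  stopping_time S tau ->
  {ae P, forall w, time_le (tau w) M} ->
  (forall i : nat, (2 <= i <= M)%N ->
    is_nondecreasing_function_of S i.-1 \1_[set w | time_lt (tau w) i]) ->
  ('E_P[stopped S tau] <= 'E_P[S M])%E.
Proof.
move=> HS tauS tauM ndtau.
have {}HS : demisubmartingale S.
  by case: HS => [/demimartingale_demisubmartingale|].
have iS := HS.1.
have M_gt0 : (0 < M)%N.
  (* Otherwise tau <= 0 almost surely, hence at some point, since P is not the
     zero measure; but tau >= 1. *)
  case: M tauM {ndtau} => // tau0.
  have P_gt0 : (0 < P setT)%E by rewrite probability_setT.
  have aeP := ae_properfilter_algebraOfSetsType P_gt0.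
  have /filter_ex[w] := tau0.
  by case E : (tau w) => [n|]//=; have := tauS.1 _ _ E; case: n {E}.
pose Y j w := (S j.+1 w - S j w) * \1_[set w | time_le (tau w) j] w.
have iY j : (1 <= j)%N -> P.-integrable setT (EFin \o Y j).
  by move=> j1; apply: integrable_increment => //; exact: iS.
pose Z := S M \- \sum_(Yj <- [seq Y j | j <- index_iota 1 M]) Yj.
have LS : (S M : T -> R) \in Lfun P 1 by apply/Lfun1_integrable/iS.
have LY Yj : Yj \in [seq Y j | j <- index_iota 1 M] -> Yj \in Lfun P 1.
  move=> /mapP[j + ->]; rewrite mem_index_iota => /andP[j1 _].
  exact/Lfun1_integrable/iY.
have LZ : \sum_(Yj <- [seq Y j | j <- index_iota 1 M]) Yj \in Lfun P 1.
  by rewrite big_seq rpred_sum.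
have -> : ('E_P[stopped S tau] = 'E_P[Z])%E.
  rewrite unlock; apply: ae_eq_integral => //.
  - apply/measurable_EFinP; exact: measurable_stopped.
  - apply: (measurable_int P); apply/Lfun1_integrable; exact: rpredB.
  - apply: filterS tauM => w /= tauM _; congr EFin.
    by rewrite (stopped_telescope _ _ _ _ _ _ tauS _ _ tauM) /Z /= big_map fct_sumE.
rewrite /Z expectationB// leeBlDr ?expectation_fin_num// leeDl//.
rewrite expectation_sum// big_map.
rewrite big_seq; apply: sume_ge0 => j; rewrite mem_index_iota => /andP[j1 jM].
apply: expectation_increment_ge0 => //; apply: (ndtau j.+1).
by rewrite ltnS j1.
Qed.
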